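(* Let $\mathbb{F}$ be any field. There is, up to isomorphism, a unique nilpotent symplectic alternating algebra $L$ over $\mathbb{F}$ of dimension $10$ that has an isotropic center of dimension $4$ and where $L^3<Z(L)$ (strict inclusion). This algebra can be given by the nilpotent presentation $$\mathcal{P}_{10}^{(4,1)}:\quad (y_2y_3,y_4)=1,\ (y_1y_4,y_5)=1,\ (x_1y_3,y_5)=1.$$
   Context: A symplectic alternating algebra (SAA) over a field $\mathbb{F}$ is a finite-dimensional vector space $L$ over $\mathbb{F}$ with a non-degenerate alternating bilinear form $(\ ,\ )$ and a bilinear product $\cdot$ satisfying $u\cdot u=0$ for all $u$ and $(u\cdot v,w)=(v\cdot w,u)$ for all $u,v,w\in L$. No associativity or Jacobi identity is assumed. The map $(u,v,w)\mapsto(uv,w)$ is then an alternating trilinear form. A standard basis (in dimension $10$) is a basis $x_1,y_1,\ldots,x_5,y_5$ with $(x_i,x_j)=(y_i,y_j)=0$ and $(x_i,y_j)=\delta_{ij}$ for all $i,j$. Presentations: $L$ is given by a presentation if there is a standard basis for which the listed values of triples $(uv,w)$ hold and $(uv,w)=0$ for all triples of basis elements that are not a reordering of a listed one. Isomorphisms are linear bijections preserving product and form. $L^1=L$, $L^{m+1}=L^mL$ (span of products, left-normed: $L^3=L^2L$). $L$ is nilpotent if $L^{m+1}=\{0\}$ for some $m\ge 0$. The center is $Z(L)=\{x\in L: xL=\{0\}\}$; it is isotropic if $(u,v)=0$ for all $u,v\in Z(L)$. *)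

(* Defs.v *)
From HB Require Import structures.
From mathcomp Require Import all_boot all_order all_algebra.
From mathcomp Require Import sesquilinear.

Set Implicit Arguments.
Unset Strict Implicit.
Unset Printing Implicit Defensive.

Import GRing.Theory.
Local Open Scope ring_scope.

Record saa (F : fieldType) := Saa {
  saa_car :> vectType F;
  saa_form : {biscalar saa_car};
  saa_mul : {bilinear saa_car -> saa_car -> saa_car};
  saa_form_alt : forall u, saa_form u u = 0;
  saa_form_nondeg : forall u, (forall v, saa_form u v = 0) -> u = 0;
  saa_mul_alt : forall u, saa_mul u u = 0;
  saa_form_mul : forall u v w,
    saa_form (saa_mul u v) w = saa_form (saa_mul v w) u
}.

Section Saa.
Variables (F : fieldType) (L : saa F).
Implicit Types (U V W : {vspace L}) (u v w : L).
Local Notation "u · v" := (saa_mul L u v) (at level 40, left associativity).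

(* The span of all products u · v with u in U and v in V; see saa_prodvP. *)
Definition saa_prodv U V : {vspace L} :=
  <<allpairs (saa_mul L) (vbasis U) (vbasis V)>>%VS.

Lemma saa_prodvP U V W :
  reflect {in U & V, forall u v, u · v \in W} (saa_prodv U V <= W)%VS.
Proof.
apply: (iffP span_subvP) => [sW u v Uu Vv | sW _ /allpairsP[[u v] /= [Uu Vv ->]]].
  rewrite (coord_vbasis Uu) (coord_vbasis Vv) linear_sumlz rpred_sum // => i _.
  rewrite linear_sumr rpred_sum // => j _.
  rewrite linearZl_LR linearZr rpredZ // rpredZ // sW //.
  by apply: allpairs_f; apply: mem_nth; rewrite size_tuple.
by apply: sW; apply: vbasis_mem.
Qed.

(* saa_lcs m is L^m for m >= 1: L^1 = L and L^(m+1) = L^m L. *)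
Definition saa_lcs (m : nat) : {vspace L} :=
  iter m.-1 (fun U => saa_prodv U fullv) fullv.

Definition saa_nilpotent : Prop := exists m, saa_lcs m.+1 = 0%VS.

(* The kernel of x |-> (y |-> x · y), as a map from L to End(L). *)
Definition saa_center : {vspace L} :=
  lker (linfun (fun x => linfun (saa_mul L x))).

Lemma saa_centerP x : reflect (forall y, x · y = 0) (x \in saa_center).
Proof.
have lin_ad : linear (fun x => linfun (saa_mul L x)).
  move=> a u v; apply/lfunP => y.
  by rewrite !lfunE /= lfunE linearPl /= !lfunE.
pose ad := GRing.isLinear.Build F L 'End(L) _ _ lin_ad.
pose adL : {linear L -> 'End(L)} := HB.pack (fun x => linfun (saa_mul L x)) ad.
rewrite memv_ker (lfunE adL) /=.
apply: (iffP eqP) => [x0 y | x0]; last first.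
  by apply/lfunP => y; rewrite lfunE /= x0 zero_lfunE.
by have /lfunP/(_ y) := x0; rewrite lfunE zero_lfunE.
Qed.

Definition saa_isotropic U : Prop := {in U &, forall u v, saa_form L u v = 0}.

End Saa.

Definition saa_isomorphic (F : fieldType) (L1 L2 : saa F) : Prop :=
  exists f : {linear L1 -> L2},
    [/\ bijective f,
        forall u v, f (saa_mul L1 u v) = saa_mul L2 (f u) (f v)
      & forall u v, saa_form L2 (f u) (f v) = saa_form L1 u v].

Definition standard_basis (F : fieldType) (L : saa F) (n : nat)
    (x y : 'I_n -> L) : Prop :=
  [/\ basis_of fullv (codom x ++ codom y),
      forall i j, saa_form L (x i) (x j) = 0,
      forall i j, saa_form L (y i) (y j) = 0
    & forall i j, saa_form L (x i) (y j) = (i == j)%:R].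

(* Generators of a presentation in dimension 2n: inl i stands for x_(i+1) and
   inr i for y_(i+1); an entry (a, b, c, r) stands for (ab, c) = r. *)
Definition saa_gen (n : nat) : finType := ('I_n + 'I_n)%type.
Definition saa_presentation (F : fieldType) (n : nat) :=
  seq (saa_gen n * saa_gen n * saa_gen n * F).

Definition presented_by (F : fieldType) (L : saa F) (n : nat)
    (P : saa_presentation F n) : Prop :=
  exists x y : 'I_n -> L,
    let e (g : saa_gen n) := match g with inl i => x i | inr i => y i end in
    [/\ standard_basis x y,
        forall a b c r, (a, b, c, r) \in P ->
          saa_form L (saa_mul L (e a) (e b)) (e c) = r
      & forall a b c,
          (forall a' b' c' r, (a', b', c', r) \in P ->
             ~~ perm_eq [:: a; b; c] [:: a'; b'; c']) ->
          saa_form L (saa_mul L (e a) (e b)) (e c) = 0].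

Definition P10_4_1 (F : fieldType) : saa_presentation F 5 :=
  let x1 := inl (@Ordinal 5 0 isT) in
  let y1 := inr (@Ordinal 5 0 isT) in
  let y2 := inr (@Ordinal 5 1 isT) in
  let y3 := inr (@Ordinal 5 2 isT) in
  let y4 := inr (@Ordinal 5 3 isT) in
  let y5 := inr (@Ordinal 5 4 isT) in
  [:: (y2, y3, y4, 1); (y1, y4, y5, 1); (x1, y3, y5, 1)].

(* Main.v *)
Require Import Defs.
From HB Require Import structures.
From mathcomp Require Import all_boot all_order all_algebra.
From mathcomp Require Import sesquilinear.
From mathcomp Require Import ring zify.

Set Implicit Arguments.
Unset Strict Implicit.
Unset Printing Implicit Defensive.

Import GRing.Theory.
Local Open Scope ring_scope.

(** Write Z for the center, P for its orthogonal complement and phi(u, v, w)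
for the alternating trilinear form (uv, w). Non-degeneracy of the form recovers
the product from phi, so an algebra is determined up to isomorphism by the
values of phi on a standard basis; in particular two algebras with the same
presentation are isomorphic ([presented_by_isomorphic]). It remains to find
such a basis in every algebra of the class, and to exhibit one algebra.

Since phi(u, v, z) = 0 for all u, v exactly when z is central, L^2 = P and
L^3 = P L. If Z is isotropic of dimension 4 in dimension 10, then P has
dimension 6 and contains Z. The inclusion of L^3 in Z says that phi(P, P, L) = 0,
and its strictness provides a vector y_2 outside P that is orthogonal to L^3,
that is, with phi(P, L, y_2) = 0. Hence K = P + <y_2> is a subspace of
codimension 3 containing Z, K/Z has dimension 3, and phi(K, K, L) = 0.

So phi induces a linear map from K/Z to the alternating forms on the
3-dimensional space L/K, and this map is injective because Z is the center: it
is an isomorphism between spaces of dimension 3. An alternating form on a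
3-dimensional space with basis e is the same thing, by the cross product
formula, as the vector that spans its radical. Through this identification a
basis (k_0, k_1, k_2) of K/Z yields a basis (f_0, f_1, f_2) of L/K, and
phi(k_i, f_j, f_l) is the determinant of the radical vectors of k_i, k_j, k_l:
after rescaling k_2 it is the sign of the permutation (i, j, l), and adding a
multiple of k_0 to f_0 makes phi(f_0, f_1, f_2) vanish ([radical_frame]).
Taking for (k_0, k_1) a hyperbolic pair (y_1, -x_1) of P and for k_2 a multiple
of y_2, and putting (f_0, f_1, f_2) = (y_3, y_4, y_5), one obtains exactly the
values of the presentation ([class_frame]). These values also show that the six vectors are
independent modulo Z, so together with Z they span L; this allows one to take
x_2, ..., x_5 in Z dual to y_2, ..., y_5, and to make the y_i isotropic by adding
central vectors, which does not change phi ([class_presented]).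

For existence, any alternating trilinear form on the standard symplectic space
defines an algebra ([trilinear_saa]). The one given by the sum of the three
minors listed in the presentation has the required values, and the invariants
of the class can be read off from them ([frame_class]). *)

(** * Families of linear functionals *)

Lemma scalar_sum (F : fieldType) (V : lmodType F) (g : V -> F) (I : finType)
    (c : I -> F) (v : I -> V) :
  scalar g -> g (\sum_i c i *: v i) = \sum_i c i * g (v i).
Proof.
move=> g_lin; elim/big_rec2: _ => [|i a b _ <-]; last exact: g_lin.
by have := g_lin (- 1) 0 0; rewrite scaler0 addr0 mulN1r addNr.
Qed.

Section JointFunctional.
Variables (F : fieldType) (V : vectType F) (I : finType) (g : I -> V -> F).
Hypothesis g_lin : forall i, scalar (g i).

Let joint v : {ffun I -> F^o} := [ffun i => g i v].
Let joint_lin : linear joint.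
Proof. by move=> a u v; apply/ffunP => i; rewrite !ffunE g_lin. Qed.
Let jointL : {linear V -> {ffun I -> F^o}} :=
  HB.pack joint (GRing.isLinear.Build F V {ffun I -> F^o} _ joint joint_lin).

(** Gathering the functionals into one linear map turns statements about common
zeros and dual vectors into rank counts. *)
Definition jointfun : 'Hom(V, {ffun I -> F^o}) := linfun jointL.

Lemma jointfunE v i : jointfun v i = g i v.
Proof. by rewrite lfunE ffunE. Qed.

Lemma jointkerP v : reflect (forall i, g i v = 0) (v \in lker jointfun).
Proof.
rewrite memv_ker; apply: (iffP eqP) => [/ffunP gv i | gv].
  by rewrite -jointfunE gv ffunE.
by apply/ffunP => i; rewrite jointfunE gv ffunE.
Qed.

Lemma dim_regular_ffun : \dim {: {ffun I -> F^o} } = #|I|.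
Proof. by rewrite dimvf /= /dim /= muln1. Qed.

Lemma dim_jointker : (\dim {:V} <= \dim (lker jointfun) + #|I|)%N.
Proof.
by rewrite -(limg_ker_dim jointfun fullv) capfv leq_add2l -dim_regular_ffun dimvS ?subvf.
Qed.

(** The joint map sends the vectors s i to the standard basis, hence is onto, and
its kernel contains U. *)
Lemma dual_dim (s : I -> V) (U : {vspace V}) :
    (forall i u, u \in U -> g i u = 0) -> (forall i j, g i (s j) = (i == j)%:R) ->
  (\dim U + #|I| <= \dim {:V})%N.
Proof.
move=> gU gs; rewrite -(limg_ker_dim jointfun fullv) capfv leq_add //.
  by apply/dimvS/subvP => u Uu; apply/jointkerP => i; rewrite gU.
rewrite -dim_regular_ffun dimvS //; apply/subvP => h _.
have -> : h = jointfun (\sum_j h j *: s j).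
  apply/ffunP => i; rewrite linear_sum sum_ffunE (bigD1 i) //= big1 ?addr0 => [|j].
    by rewrite linearZ ffunE jointfunE gs eqxx [_ *: _]mulr1.
  by rewrite linearZ ffunE !jointfunE gs eq_sym => /negPf->; rewrite [_ *: _]mulr0.
by rewrite memv_img ?memvf.
Qed.

(** Equality in the bound [dual_dim] forces U to be the whole common kernel, in
which the difference lies by construction. *)
Lemma dual_decomp (s : I -> V) (U : {vspace V}) v :
    (forall i u, u \in U -> g i u = 0) -> (forall i j, g i (s j) = (i == j)%:R) ->
    (\dim {:V} <= \dim U + #|I|)%N ->
  v - \sum_i g i v *: s i \in U.
Proof.
move=> gU gs dimU; suffices ->: U = lker jointfun.
  apply/jointkerP => i; rewrite -jointfunE linearB linear_sum ffunE /= !ffunE sum_ffunE.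
  rewrite (bigD1 i) //= big1 ?addr0 => [|j].
    by rewrite linearZ ffunE !jointfunE gs eqxx [_ *: _]mulr1 subrr.
  by rewrite linearZ ffunE !jointfunE gs eq_sym => /negPf->; rewrite [_ *: _]mulr0.
apply/eqP; rewrite eqEdim; apply/andP; split.
  by apply/subvP => u Uu; apply/jointkerP => i; rewrite gU.
rewrite -(leq_add2r #|I|) (leq_trans _ dimU) //.
by apply: dual_dim gs => i u /jointkerP.
Qed.

(** The joint map embeds U in a coordinate space of the same dimension, so the unit
vectors have preimages in U. *)
Lemma dual_family (U : {vspace V}) :
    \dim U = #|I| -> (forall u, u \in U -> (forall i, g i u = 0) -> u = 0) ->
  exists2 s : I -> V, forall i, s i \in U & forall i j, g i (s j) = (i == j)%:R.
Proof.
move=> dimU gU0.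
have imU : (jointfun @: U)%VS = fullv.
  apply/eqP; rewrite eqEdim subvf dim_regular_ffun limg_dim_eq ?dimU ?leqnn //.
  apply/eqP; rewrite eqEsubv sub0v andbT; apply/subvP => u /memv_capP[Uu /jointkerP gu].
  by rewrite memv0 (gU0 u).
have /fin_all_exists2[s Us gs] j : exists2 u, u \in U & forall i, g i u = (i == j)%:R.
  have : [ffun i => (i == j)%:R : F^o] \in (jointfun @: U)%VS by rewrite imU memvf.
  case/memv_imgP=> u Uu Eu; exists u => // i; move/ffunP/(_ i): Eu.
  by rewrite jointfunE ffunE.
by exists s.
Qed.

End JointFunctional.

(** * The trilinear form, the center and orthogonal complements *)

Section SaaTheory.
Variables (F : fieldType) (L : saa F).
Implicit Types (U : {vspace L}) (u v w : L) (a : F).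

Local Notation "⟨ u , v ⟩" := (saa_form L u v) (at level 0, format "⟨ u ,  v ⟩").
Local Notation "u · v" := (saa_mul L u v) (at level 40, left associativity).
Local Notation Z := (saa_center L).

Lemma form_scalarl v : scalar (fun u => ⟨u, v⟩).
Proof. by move=> a x y; rewrite linearPl. Qed.

Lemma form_scalarr u : scalar (fun v => ⟨u, v⟩).
Proof. by move=> a x y; rewrite linearPr. Qed.

Lemma saa_formC u v : ⟨u, v⟩ = - ⟨v, u⟩.
Proof.
have := saa_form_alt (u + v); rewrite linearDl /= !linearDr /= !saa_form_alt.
by rewrite add0r addr0 => /eqP; rewrite addr_eq0 => /eqP.
Qed.

Lemma saa_mulC u v : u · v = - (v · u).
Proof.
have := saa_mul_alt (u + v); rewrite linearDl /= !linearDr /= !saa_mul_alt.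
by rewrite add0r addr0 => /eqP; rewrite addr_eq0 => /eqP.
Qed.

Definition tri u v w := ⟨u · v, w⟩.

Lemma tri_rot u v w : tri u v w = tri v w u.
Proof. exact: saa_form_mul. Qed.
Lemma triC u v w : tri u v w = - tri v u w.
Proof. by rewrite /tri saa_mulC linearNl. Qed.
Lemma triC23 u v w : tri u v w = - tri u w v.
Proof. by rewrite tri_rot triC -tri_rot triC opprK tri_rot triC tri_rot. Qed.
Lemma tri_alt12 u w : tri u u w = 0.
Proof. by rewrite /tri saa_mul_alt linear0l. Qed.
Lemma tri_alt23 u w : tri w u u = 0.
Proof. by rewrite tri_rot tri_alt12. Qed.
Lemma tri_alt13 u w : tri u w u = 0.
Proof. by rewrite -tri_rot tri_alt12. Qed.

Lemma tri_scalar1 v w : scalar (fun u => tri u v w).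
Proof. by move=> a x y; rewrite /tri linearPl linearPl. Qed.
Lemma tri_scalar2 u w : scalar (fun v => tri u v w).
Proof. by move=> a x y; rewrite /tri linearPr linearPl. Qed.
Lemma tri_scalar3 u v : scalar (fun w => tri u v w).
Proof. by move=> a x y; rewrite /tri linearPr. Qed.

Lemma triD1 u u' v w : tri (u + u') v w = tri u v w + tri u' v w.
Proof. by rewrite -[u]scale1r tri_scalar1 scale1r mul1r. Qed.
Lemma triD2 u v v' w : tri u (v + v') w = tri u v w + tri u v' w.
Proof. by rewrite -[v]scale1r tri_scalar2 scale1r mul1r. Qed.
Lemma triD3 u v w w' : tri u v (w + w') = tri u v w + tri u v w'.
Proof. by rewrite -[w]scale1r tri_scalar3 scale1r mul1r. Qed.
Lemma triZ1 a u v w : tri (a *: u) v w = a * tri u v w.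
Proof. by rewrite /tri linearZl_LR linearZl_LR. Qed.
Lemma triZ2 a u v w : tri u (a *: v) w = a * tri u v w.
Proof. by rewrite /tri linearZr_LR linearZl_LR. Qed.
Lemma triZ3 a u v w : tri u v (a *: w) = a * tri u v w.
Proof. by rewrite /tri linearZr_LR. Qed.
Lemma triN1 u v w : tri (- u) v w = - tri u v w.
Proof. by rewrite -scaleN1r triZ1 mulN1r. Qed.
Lemma triN2 u v w : tri u (- v) w = - tri u v w.
Proof. by rewrite -scaleN1r triZ2 mulN1r. Qed.
Lemma triN3 u v w : tri u v (- w) = - tri u v w.
Proof. by rewrite -scaleN1r triZ3 mulN1r. Qed.
Definition triE := (triD1, triD2, triD3, triZ1, triZ2, triZ3, triN1, triN2, triN3).

Lemma centerP u : reflect (forall v w, tri u v w = 0) (u \in Z).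
Proof.
apply: (iffP (saa_centerP u)) => [u0 v w | u0 v]; first by rewrite /tri u0 linear0l.
by apply: saa_form_nondeg => w; apply: u0.
Qed.

Lemma tri_center1 z v w : z \in Z -> tri z v w = 0.
Proof. by move/centerP. Qed.
Lemma tri_center2 u z w : z \in Z -> tri u z w = 0.
Proof. by move=> Zz; rewrite tri_rot tri_center1. Qed.
Lemma tri_center3 u v z : z \in Z -> tri u v z = 0.
Proof. by move=> Zz; rewrite -tri_rot tri_center1. Qed.

Definition orthv U : {vspace L} :=
  lker (jointfun (fun i : 'I_(\dim U) => form_scalarr (vbasis U)`_i)).

Lemma orthvP U v : reflect {in U, forall u, ⟨u, v⟩ = 0} (v \in orthv U).
Proof.
apply: (iffP (jointkerP _ _)) => [Uv u Uu | Uv i].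
  rewrite (coord_vbasis Uu) linear_sumlz big1 // => i _.
  by rewrite linearZl_LR Uv mulr0.
by apply: Uv; apply: vbasis_mem; rewrite mem_nth ?size_tuple.
Qed.

Lemma orthv_line u v : (v \in orthv <[u]>%VS) = (⟨u, v⟩ == 0).
Proof.
apply/orthvP/eqP => [-> //|uv _ /vlineP[a ->]]; first exact: memv_line.
by rewrite linearZl_LR uv mulr0.
Qed.

Lemma orthv_in U u v : u \in U -> v \in orthv U -> ⟨u, v⟩ = 0.
Proof. by move=> Uu /orthvP->. Qed.

(** The orthogonal complement of W is cut out by dim W equations, so its dimension
is at least dim L - dim W. Apply this to U and to a complement of U: the two
orthogonal complements meet trivially by non-degeneracy, which leaves no room
for a strict inequality. *)
Lemma dim_orthv U : (\dim (orthv U) + \dim U = \dim {:L})%N.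
Proof.
have geV W : (\dim {:L} <= \dim (orthv W) + \dim W)%N.
  have := dim_jointker (fun i : 'I_(\dim W) => form_scalarr (vbasis W)`_i).
  by rewrite card_ord.
have dimC : (\dim U + \dim U^C = \dim {:L})%N.
  by rewrite dimv_compl subnKC ?dimvS ?subvf.
have cap0 : (orthv U :&: orthv U^C = 0)%VS.
  apply/eqP; rewrite eqEsubv sub0v andbT; apply/subvP => v /memv_capP[Uv UCv].
  rewrite memv0; apply/eqP/saa_form_nondeg => w; rewrite saa_formC.
  have : w \in (U + U^C)%VS by rewrite addv_complf memvf.
  case/memv_addP=> u Uu [u' UCu' ->].
  by rewrite linearDl /= (orthv_in Uu Uv) (orthv_in UCu' UCv) addr0 oppr0.
have := dimvS (subvf (orthv U + orthv U^C)); rewrite dimv_disjoint_sum //.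
by have := geV U; have := geV U^C%VS; lia.
Qed.

Lemma orthvK U : orthv (orthv U) = U.
Proof.
apply/eqP; rewrite eq_sym eqEdim; apply/andP; split.
  by apply/subvP => u Uu; apply/orthvP => v Uv; rewrite saa_formC (orthv_in Uu) ?oppr0.
by have := dim_orthv U; have := dim_orthv (orthv U); lia.
Qed.

Lemma orthvS U1 U2 : (U1 <= U2)%VS -> (orthv U2 <= orthv U1)%VS.
Proof.
move=> sU; apply/subvP => v /orthvP U2v; apply/orthvP => u U1u.
by apply: U2v; apply: (subvP sU).
Qed.

End SaaTheory.

(** * Frames *)

(** The triple product is spelled out as a polynomial so that determinant
identities between values of the trilinear form are ring identities. *)
Definition det3 (F : fieldType) (a0 a1 a2 b0 b1 b2 c0 c1 c2 : F) : F :=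
  a0 * (b1 * c2 - b2 * c1) + a1 * (b2 * c0 - b0 * c2) + a2 * (b0 * c1 - b1 * c0).

Lemma det3_eq0 (F : fieldType) (a0 a1 a2 b0 b1 b2 c0 c1 c2 : F) :
    det3 a0 a1 a2 b0 b1 b2 c0 c1 c2 = 0 ->
  exists a b c : F,
    [/\ ~ [/\ a = 0, b = 0 & c = 0], a * a0 + b * b0 + c * c0 = 0,
        a * a1 + b * b1 + c * c1 = 0 & a * a2 + b * b2 + c * c2 = 0].
Proof.
move=> det0.
pose M : 'M[F]_3 := \matrix_(i, j)
  (nth [::] [:: [:: a0; a1; a2]; [:: b0; b1; b2]; [:: c0; c1; c2]] i)`_j.
have /eqP/det0P[v v0 vM] : \det M = 0.
  rewrite -{}det0 (expand_det_row _ ord0) !big_ord_recl big_ord0 /cofactor.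
  rewrite !(expand_det_row _ ord0) !big_ord_recl !big_ord0 /cofactor !det_mx11 !mxE /=.
  by rewrite /det3 /bump /=; ring.
pose i1 : 'I_3 := lift ord0 ord0; pose i2 : 'I_3 := lift ord0 (lift ord0 ord0).
exists (v 0 ord0), (v 0 i1), (v 0 i2); split.
- case=> v00 v01 v02; case/eqP: v0; apply/rowP => j; rewrite mxE.
  case: j => [[|[|[|//]]] lt_j].
  + by rewrite -[RHS]v00; congr (v _ _); apply: val_inj.
  + by rewrite -[RHS]v01; congr (v _ _); apply: val_inj.
  + by rewrite -[RHS]v02; congr (v _ _); apply: val_inj.
- by have /rowP/(_ ord0) := vM; rewrite !mxE !big_ord_recl big_ord0 !mxE addr0 addrA.
- by have /rowP/(_ i1) := vM; rewrite !mxE !big_ord_recl big_ord0 !mxE addr0 addrA.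
- by have /rowP/(_ i2) := vM; rewrite !mxE !big_ord_recl big_ord0 !mxE addr0 addrA.
Qed.

Section Frames.
Variables (F : fieldType) (L : saa F).
Implicit Types (U K : {vspace L}) (u v w k : L) (a : F).
Local Notation Z := (saa_center L).

(** The normal form of phi: the k's span a subspace T modulo the center with
phi(T, T, L) = 0, and phi(k_i, f_j, f_l) is the sign of the permutation
(i, j, l), so that phi identifies T with the alternating forms on the span of
the f's. The presentation is the case where k is (y_1, -x_1, y_2) and f is
(y_3, y_4, y_5). *)
Definition frame k0 k1 k2 f0 f1 f2 : Prop :=
  [/\ [/\ forall w, tri k0 k1 w = 0, forall w, tri k1 k2 w = 0 & forall w, tri k2 k0 w = 0],
      [/\ tri k0 f1 f2 = 1, tri k0 f2 f0 = 0 & tri k0 f0 f1 = 0],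
      [/\ tri k1 f1 f2 = 0, tri k1 f2 f0 = 1 & tri k1 f0 f1 = 0],
      [/\ tri k2 f1 f2 = 0, tri k2 f2 f0 = 0 & tri k2 f0 f1 = 1]
    & tri f0 f1 f2 = 0].

Section Radical.
Variables (K : {vspace L}) (e0 e1 e2 : L).
Hypothesis KK0 : forall k k' w, k \in K -> k' \in K -> tri k k' w = 0.
Hypothesis KeL : forall v, exists k a0 a1 a2,
  k \in K /\ v = k + (a0 *: e0 + a1 *: e1 + a2 *: e2).

(** An alternating form B on a space with basis e0, e1, e2 is determined by the
vector B(e1, e2) e0 + B(e2, e0) e1 + B(e0, e1) e2, which lies in its radical.
Here B is phi(w, _, _). *)
Definition radical w := tri w e1 e2 *: e0 + tri w e2 e0 *: e1 + tri w e0 e1 *: e2.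

(** With respect to e, the form phi(u, _, _) is the triple product with the vector
[radical u]. *)
Lemma tri_radical u v w :
  tri u (radical v) (radical w) =
    det3 (tri u e1 e2) (tri u e2 e0) (tri u e0 e1)
         (tri v e1 e2) (tri v e2 e0) (tri v e0 e1)
         (tri w e1 e2) (tri w e2 e0) (tri w e0 e1).
Proof.
rewrite /radical !triE !tri_alt23 (triC23 u e2 e1) (triC23 u e0 e2) (triC23 u e1 e0) /det3.
by ring.
Qed.

(** As phi(w, _, _) vanishes on K, it only depends on its values on the e's. *)
Lemma central_in_K w : w \in K ->
  tri w e1 e2 = 0 -> tri w e2 e0 = 0 -> tri w e0 e1 = 0 -> w \in Z.
Proof.
move=> Kw w12 w20 w01; apply/centerP => u v.
have [k [a0 [a1 [a2 [Kk ->]]]]] := KeL u; have [k' [b0 [b1 [b2 [Kk' ->]]]]] := KeL v.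
have wKe e : tri w e k' = 0 by rewrite triC23 KK0 ?oppr0.
rewrite !triE !(KK0 _ Kw Kk) !wKe !tri_alt23.
by rewrite (triC23 w e2 e1) (triC23 w e0 e2) (triC23 w e1 e0) w12 w20 w01; ring.
Qed.

(** All values phi(k_i, f_j, f_l) with f_j the radical vector of k_j are, by
[tri_radical], determinants with rows among those of one 3x3 matrix: zero if a
row is repeated, and the determinant up to sign otherwise. That matrix is
invertible because the k's are independent modulo the center. *)
Lemma radical_frame k0 k1 k2 : k0 \in K -> k1 \in K -> k2 \in K ->
    (forall a0 a1 a2, a0 *: k0 + a1 *: k1 + a2 *: k2 \in Z ->
       [/\ a0 = 0, a1 = 0 & a2 = 0]) ->
  exists (a : F) f0 f1 f2, frame k0 k1 (a *: k2) f0 f1 f2.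
Proof.
move=> Kk0 Kk1 Kk2 free_k.
pose D := det3 (tri k0 e1 e2) (tri k0 e2 e0) (tri k0 e0 e1)
               (tri k1 e1 e2) (tri k1 e2 e0) (tri k1 e0 e1)
               (tri k2 e1 e2) (tri k2 e2 e0) (tri k2 e0 e1).
have D0 : D != 0.
  apply/eqP => /det3_eq0[a [b [c [abc0 abc12 abc20 abc01]]]]; apply: abc0.
  by apply: free_k; apply: central_in_K; rewrite ?memvD ?memvZ ?triE.
(* The determinant is linear in k2, so dividing k2 by D makes it equal to 1. *)
exists D^-1; move: (memvZ D^-1 Kk2).
have : tri k0 (radical k1) (radical (D^-1 *: k2)) = 1.
  by rewrite tri_radical !triE; apply: (mulIf D0); rewrite mul1r -{2}/D /D /det3; field.
move: (D^-1 *: k2) => k D1 Kk.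
(* Adding a multiple of k0 kills the value at (f0, f1, f2) without affecting the
   others, as phi vanishes on pairs of vectors of K. *)
pose f0 := radical k0 - tri (radical k0) (radical k1) (radical k) *: k0.
exists f0, (radical k1), (radical k).
have Kf2 k' w : k' \in K -> tri k' f0 w = tri k' (radical k0) w.
  by move=> Kk'; rewrite /f0 triD2 triN2 triZ2 (KK0 _ Kk' Kk0) mulr0 oppr0 addr0.
have Kf3 k' w : k' \in K -> tri k' w f0 = tri k' w (radical k0).
  by move=> Kk'; rewrite triC23 Kf2 // -triC23.
split; [split=> w; exact: KK0 | split | split | split
  | by rewrite /f0 triD1 triN1 triZ1 D1 mulr1 subrr].
all: rewrite ?Kf2 ?Kf3 // ?tri_radical -?D1 ?tri_radical /det3; ring.
Qed.
End Radical.
End Frames.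

Section FrameBasis.
Variables (F : fieldType) (L : saa F) (k0 k1 k2 f0 f1 f2 : L).
Hypothesis kf : frame k0 k1 k2 f0 f1 f2.
Local Notation Z := (saa_center L).

(** The coordinates modulo the center with respect to a frame can be read off with
phi, because phi is known on the frame. *)
Definition frame_coord (i : 'I_6) (u : L) : F :=
  [:: tri u f1 f2; tri u f2 f0; tri u f0 f1; tri u k1 f2; tri u k2 f0; tri u k0 f1]`_i.

Lemma frame_coord_scalar i : scalar (frame_coord i).
Proof. by case: i => [[|[|[|[|[|[|//]]]]]] ?] a u v; rewrite /frame_coord /= tri_scalar1. Qed.

Lemma frame_coord_dual (i j : 'I_6) :
  frame_coord i [:: k0; k1; k2; f0; f1; f2]`_j = (i == j)%:R.
Proof.
have [[k01 k12 k20] [e0 e1 e2] [e3 e4 e5] [e6 e7 e8] e9] := kf.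
have E := (k01, k12, k20, e0, e1, e2, e3, e4, e5, e6, e7, e8, e9,
           tri_alt12, tri_alt23, tri_alt13).
case: i j => [[|[|[|[|[|[|//]]]]]] ?] [[|[|[|[|[|[|//]]]]]] ?]; rewrite /frame_coord /=.
all: first [ by rewrite !E | by rewrite tri_rot !E | by rewrite -tri_rot !E
           | by rewrite triC !E oppr0 | by rewrite triC23 !E oppr0
           | by rewrite tri_rot triC !E oppr0 ].
Qed.

Lemma frame_dim_center : (\dim Z + 6 <= \dim {:L})%N.
Proof.
rewrite -[6%N]card_ord; apply: (dual_dim frame_coord_scalar _ frame_coord_dual) => i u Zu.
by case: i => [[|[|[|[|[|[|//]]]]]] ?]; apply: tri_center1.
Qed.

Lemma frame_span v : (\dim {:L} <= \dim Z + 6)%N ->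
  v \in (Z + <<[:: k0; k1; k2; f0; f1; f2]>>)%VS.
Proof.
rewrite -[6%N]card_ord => dimL.
rewrite -[v](subrK (\sum_i frame_coord i v *: [:: k0; k1; k2; f0; f1; f2]`_i)) memv_add //.
  apply: (dual_decomp frame_coord_scalar v _ frame_coord_dual dimL) => i u Zu.
  by case: i => [[|[|[|[|[|[|//]]]]]] ?]; apply: tri_center1.
by apply: memv_suml => i _; rewrite memvZ // memv_span // mem_nth.
Qed.
End FrameBasis.

(** * Standard bases and presentations *)

Section StandardBasis.
Variables (F : fieldType) (L : saa F) (n : nat) (x y : 'I_n -> L).
Local Notation "⟨ u , v ⟩" := (saa_form L u v) (at level 0, format "⟨ u ,  v ⟩").

Definition gen_val (g : saa_gen n) : L := match g with inl i => x i | inr i => y i end.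
Definition gen_coord (g : saa_gen n) (u : L) : F :=
  match g with inl i => ⟨u, y i⟩ | inr i => ⟨x i, u⟩ end.

Lemma gen_coord_scalar g : scalar (gen_coord g).
Proof. by case: g => i a u v; rewrite /gen_coord ?form_scalarl ?form_scalarr. Qed.

Hypothesis xx : forall i j, ⟨x i, x j⟩ = 0.
Hypothesis yy : forall i j, ⟨y i, y j⟩ = 0.
Hypothesis xy : forall i j, ⟨x i, y j⟩ = (i == j)%:R.

Lemma gen_coord_dual g h : gen_coord g (gen_val h) = (g == h)%:R.
Proof. by case: g h => i [] j /=; rewrite ?xx ?yy ?xy // eq_sym. Qed.

Lemma gen_coord_sum g (c : saa_gen n -> F) : gen_coord g (\sum_h c h *: gen_val h) = c g.
Proof.
rewrite (scalar_sum _ _ (gen_coord_scalar g)) (bigD1 g) //= gen_coord_dual eqxx mulr1.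
by rewrite big1 ?addr0 // => h; rewrite gen_coord_dual eq_sym => /negPf->; rewrite mulr0.
Qed.

Lemma gen_expand u : (\dim {:L} <= n + n)%N -> u = \sum_g gen_coord g u *: gen_val g.
Proof.
move=> dimL; apply/eqP; rewrite -subr_eq0 -memv0.
apply: (dual_decomp gen_coord_scalar _ _ gen_coord_dual) => [g v|].
  rewrite memv0 => /eqP->; rewrite -[0](scale0r 0) -[X in gen_coord _ X]addr0.
  by rewrite gen_coord_scalar mul0r add0r; case: g => i /=; rewrite ?linear0l ?linear0r.
by rewrite dimv0 add0n card_sum card_ord.
Qed.

Lemma standard_basisP : \dim {:L} = (n + n)%N -> standard_basis x y.
Proof.
move=> dimL; split=> //; rewrite basisEdim size_cat !size_codom !card_ord dimL leqnn andbT.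
apply/subvP => u _; rewrite (gen_expand u) ?dimL //; apply: memv_suml => g _.
by rewrite memvZ // memv_span // mem_cat; case: g => i /=; rewrite codom_f ?orbT.
Qed.
End StandardBasis.

Lemma standard_basis_dim (F : fieldType) (L : saa F) n (x y : 'I_n -> L) :
  standard_basis x y -> \dim {:L} = (n + n)%N.
Proof.
case=> /andP[/eqP <- /eqP ->] _ _ _.
by rewrite size_cat !size_codom !card_ord.
Qed.

Lemma perm3_ind (T : eqType) (Q : T -> T -> T -> Prop) :
    (forall a b c, Q a b c -> Q b a c) -> (forall a b c, Q a b c -> Q a c b) ->
  forall a b c a' b' c', perm_eq [:: a; b; c] [:: a'; b'; c'] -> Q a' b' c' -> Q a b c.
Proof.
move=> Q12 Q23.
have fix1 a b c b' c' : perm_eq [:: a; b; c] [:: a; b'; c'] -> Q a b' c' -> Q a b c.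
  rewrite perm_cons => bc Qa; have : b \in [:: b'; c'] by rewrite -(perm_mem bc) mem_head.
  rewrite !inE => /orP[] /eqP Eb; move: bc; rewrite {b}Eb.
    by rewrite perm_cons => /(perm_small_eq (s2 := [:: _]) isT)[->].
  move/perm_trans/(_ (permEl (perm_catC [:: b'] [:: c']))).
  by rewrite perm_cons => /(perm_small_eq (s2 := [:: _]) isT)[->]; apply: Q23.
move=> a b c a' b' c' abc Qabc.
have : a \in [:: a'; b'; c'] by rewrite -(perm_mem abc) mem_head.
rewrite !inE => /or3P[] /eqP Ea; move: abc; rewrite {a}Ea.
- by move/fix1; apply.
- move/perm_trans/(_ (permEl (perm_catCA [:: a'] [:: b'] [:: c']))) => /fix1; apply.
  exact: Q12.
- move/perm_trans/(_ (permEl (perm_catC [:: a'; b'] [:: c']))) => /fix1; apply.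
  exact/Q12/Q23.
Qed.

(** A property of alternating forms need only be checked on increasing triples. *)
Lemma sorted3_ind (T : Type) (rho : T -> nat) (Q : T -> T -> T -> Prop) :
    injective rho -> (forall a b, Q a a b) ->
    (forall a b c, Q a b c -> Q b a c) -> (forall a b c, Q a b c -> Q a c b) ->
    (forall a b c, (rho a < rho b)%N -> (rho b < rho c)%N -> Q a b c) ->
  forall a b c, Q a b c.
Proof.
move=> rho_inj Qaa Q12 Q23 Qlt.
have Q_lt a b c : (rho a < rho b)%N -> Q a b c.
  move=> ab; case: (ltngtP (rho b) (rho c)) => [bc|cb|/rho_inj <-]; first exact: Qlt.
    apply: Q23; case: (ltngtP (rho a) (rho c)) => [ac|ca|/rho_inj <-] //; first exact: Qlt.
    exact/Q12/Qlt.
  exact/Q12/Q23/Qaa.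
move=> a b c; case: (ltngtP (rho a) (rho b)) => [|ba|/rho_inj <-] //; first exact: Q_lt.
exact/Q12/Q_lt.
Qed.

Section Isomorphism.
Variables (F : fieldType) (L L' : saa F) (n : nat) (x y : 'I_n -> L) (x' y' : 'I_n -> L').
Hypotheses (sb : standard_basis x y) (sb' : standard_basis x' y').
Hypothesis eq_tri : forall a b c,
  tri (gen_val x y a) (gen_val x y b) (gen_val x y c) =
  tri (gen_val x' y' a) (gen_val x' y' b) (gen_val x' y' c).

Let transfer (u : L) : L' := \sum_g gen_coord x y g u *: gen_val x' y' g.
Let transfer_back (u : L') : L := \sum_g gen_coord x' y' g u *: gen_val x y g.

Let transfer_lin : linear transfer.
Proof.
move=> a u v; rewrite /transfer scaler_sumr -big_split; apply: eq_bigr => g _ /=.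
by rewrite gen_coord_scalar scalerDl scalerA.
Qed.
Let transferL : {linear L -> L'} :=
  HB.pack transfer (GRing.isLinear.Build F L L' _ transfer transfer_lin).

Let expand u : u = \sum_g gen_coord x y g u *: gen_val x y g.
Proof. by case: sb => ? ? ? ?; apply: gen_expand => //; rewrite (standard_basis_dim sb). Qed.
Let expand' u : u = \sum_g gen_coord x' y' g u *: gen_val x' y' g.
Proof. by case: sb' => ? ? ? ?; apply: gen_expand => //; rewrite (standard_basis_dim sb'). Qed.

(** The linear map that matches the two bases preserves the form and phi; as it is
onto, non-degeneracy shows that it preserves the product. *)
Lemma same_constants_isomorphic : saa_isomorphic L L'.
Proof.
have [_ xx yy xy] := sb; have [_ xx' yy' xy'] := sb'.
have coordT g u : gen_coord x' y' g (transfer u) = gen_coord x y g u.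
  exact: gen_coord_sum.
have TK : cancel transfer transfer_back.
  by move=> u; rewrite [RHS]expand; apply: eq_bigr => g _; rewrite coordT.
have KT : cancel transfer_back transfer.
  move=> u; rewrite [RHS]expand'; apply: eq_bigr => g _; congr (_ *: _).
  exact: gen_coord_sum.
have formT u v : saa_form L' (transfer u) (transfer v) = saa_form L u v.
  rewrite {2}[u]expand {2}[v]expand /transfer.
  rewrite !(scalar_sum _ _ (form_scalarl _)); apply: eq_bigr => g _; congr (_ * _).
  rewrite !(scalar_sum _ _ (form_scalarr _)); apply: eq_bigr => h _; congr (_ * _).
  case: g h => i [] j /=; rewrite ?xx ?xx' ?yy ?yy' ?xy ?xy' //.
  by rewrite saa_formC (saa_formC (y i)) xy xy'.
have triT u v w : tri (transfer u) (transfer v) (transfer w) = tri u v w.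
  rewrite {2}[u]expand {2}[v]expand {2}[w]expand /transfer.
  rewrite !(scalar_sum _ _ (tri_scalar1 _ _)); apply: eq_bigr => a _; congr (_ * _).
  rewrite !(scalar_sum _ _ (tri_scalar2 _ _)); apply: eq_bigr => b _; congr (_ * _).
  by rewrite !(scalar_sum _ _ (tri_scalar3 _ _)); apply: eq_bigr => c _; rewrite eq_tri.
exists transferL; split; [by exists transfer_back | | exact: formT] => u v.
apply/eqP; rewrite -subr_eq0; apply/eqP/saa_form_nondeg => w.
by rewrite -[w]KT linearBl /= formT [X in _ - X]triT subrr.
Qed.
End Isomorphism.

(** A presentation determines phi on the listed triples, on their reorderings by
alternation, and gives 0 elsewhere. *)
Lemma presented_by_isomorphic (F : fieldType) (L L' : saa F) n (P : saa_presentation F n) :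
  presented_by L P -> presented_by L' P -> saa_isomorphic L L'.
Proof.
case=> x [y [sb PL P0]] [x' [y' [sb' PL' P0']]].
apply: (same_constants_isomorphic sb sb') => a b c.
have [/hasP[[[[a' b'] c'] r] Pabc /= abc]|] := boolP (has (fun q : saa_gen n * _ * _ * F =>
    perm_eq [:: a; b; c] [:: q.1.1.1; q.1.1.2; q.1.2]) P).
  pose Q u v w := tri (gen_val x y u) (gen_val x y v) (gen_val x y w) =
    tri (gen_val x' y' u) (gen_val x' y' v) (gen_val x' y' w).
  apply: (perm3_ind (Q := Q) _ _ abc) => [u v w E|u v w E|]; rewrite /Q.
  - by rewrite triC E -triC.
  - by rewrite triC23 E -triC23.
  - by rewrite /tri (PL _ _ _ _ Pabc) (PL' _ _ _ _ Pabc).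
move/hasPn => nP; rewrite /tri P0 ?P0' // => a' b' c' r /nP //.
Qed.

(** * From frames to the presentation and its invariants *)

Section LowerCentralSeries.
Variables (F : fieldType) (L : saa F).
Local Notation Z := (saa_center L).

(** Both spaces have the same orthogonal complement: z is orthogonal to every
product exactly when phi(_, _, z) = 0. *)
Lemma lcs2E : saa_lcs L 2 = orthv Z.
Proof.
rewrite /saa_lcs /=; set L2 := saa_prodv _ _.
have L2P u v : saa_mul L u v \in L2 by apply: (saa_prodvP _ _ _ (subvv L2)); rewrite memvf.
apply/eqP; rewrite eqEsubv; apply/andP; split.
  apply/saa_prodvP => u v _ _; apply/orthvP => z Zz.
  by rewrite saa_formC [X in - X]tri_center3 ?oppr0.
rewrite -[X in (_ <= X)%VS]orthvK; apply/orthvS/subvP => z /orthvP L2z.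
by apply/centerP => u v; rewrite tri_rot; apply: L2z.
Qed.

Lemma lcs3_subP (U : {vspace L}) :
  reflect (forall p w, p \in orthv Z -> saa_mul L p w \in U) (saa_lcs L 3 <= U)%VS.
Proof.
rewrite [saa_lcs L 3]/(saa_prodv (saa_lcs L 2) fullv) lcs2E.
by apply: (iffP (saa_prodvP _ _ _)) => PU p w => [Pp|Pp _]; apply: PU; rewrite ?memvf.
Qed.
End LowerCentralSeries.

Definition class10_4_1 (F : fieldType) (L : saa F) : Prop :=
  [/\ saa_nilpotent L,
      \dim {:L} = 10%N,
      saa_isotropic (saa_center L),
      \dim (saa_center L) = 4%N
    & (saa_lcs L 3 <= saa_center L)%VS /\ saa_lcs L 3 <> saa_center L].

Section FromFrame.
Variables (F : fieldType) (L : saa F) (x y : 'I_5 -> L).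
Local Notation Z := (saa_center L).
Local Notation o0 := (@Ordinal 5 0 isT).
Local Notation o1 := (@Ordinal 5 1 isT).
Local Notation o2 := (@Ordinal 5 2 isT).
Local Notation o3 := (@Ordinal 5 3 isT).
Local Notation o4 := (@Ordinal 5 4 isT).
Hypothesis sb : standard_basis x y.
Hypothesis Zx : forall i, i != o0 -> x i \in Z.
Hypothesis kf : frame (y o0) (- x o0) (y o1) (y o2) (y o3) (y o4).

Lemma ord5_ind (P : 'I_5 -> Prop) : P o0 -> P o1 -> P o2 -> P o3 -> P o4 -> forall i, P i.
Proof.
move=> P0 P1 P2 P3 P4 [[|[|[|[|[|//]]]]] i].
all: by rewrite (bool_irrelevance i isT).
Qed.

(** The central generators come first, so that an increasing triple that involves
one of them starts with it; then x_1, y_1, ..., y_5, for which the listed triples of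
the presentation are increasing. *)
Definition gen_rank (g : saa_gen 5) : nat :=
  match g with inl i => if i == o0 then 4 else i.-1 | inr i => (5 + i)%N end.

Lemma gen_rank_inj : injective gen_rank.
Proof. by case=> i; elim/ord5_ind: i => [] [] j; elim/ord5_ind: j. Qed.

Lemma frame_presented : presented_by L (P10_4_1 F).
Proof.
exists x, y; set e := fun g => _.
have [[k01 k12 k20] [e0 e1 e2] [e3 e4 e5] [e6 e7 e8] e9] := kf.
(* The frame relations, rewritten on increasing triples and in terms of x_1. *)
have [{}e0 {}e1 {}e2] : [/\ tri (y o0) (y o3) (y o4) = 1,
    tri (y o0) (y o2) (y o4) = 0 & tri (y o0) (y o2) (y o3) = 0].
  by split; rewrite // triC23 e1 oppr0.
have [{}e3 {}e4 {}e5] : [/\ tri (x o0) (y o3) (y o4) = 0,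
    tri (x o0) (y o2) (y o4) = 1 & tri (x o0) (y o2) (y o3) = 0].
  move: e3 e4 e5; rewrite !triN1 (triC23 _ (y o4)) opprK => /eqP + -> /eqP.
  by rewrite !oppr_eq0 => /eqP -> /eqP ->.
have [{}e6 {}e7 {}e8] : [/\ tri (y o1) (y o3) (y o4) = 0,
    tri (y o1) (y o2) (y o4) = 0 & tri (y o1) (y o2) (y o3) = 1].
  by split; rewrite // triC23 e7 oppr0.
have {}k01 w : tri (x o0) (y o0) w = 0 by move: (k01 w); rewrite triC triN1 opprK.
have {}k12 w : tri (x o0) (y o1) w = 0.
  by move: (k12 w); rewrite triN1 => /eqP; rewrite oppr_eq0 => /eqP.
have {}k20 w : tri (y o0) (y o1) w = 0 by rewrite triC k20 oppr0.
split=> // [a b c r|].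
  by rewrite !inE => /or3P[] /eqP[-> -> -> ->].
move=> a b c; pose Q u v w := (forall a' b' c' r, (a', b', c', r) \in P10_4_1 F ->
   ~~ perm_eq [:: u; v; w] [:: a'; b'; c']) -> tri (e u) (e v) (e w) = 0.
suffices : Q a b c by [].
move: a b c; apply: (sorted3_ind gen_rank_inj).
- by move=> u v _; apply: tri_alt12.
- move=> u v w Quvw nP; rewrite triC Quvw ?oppr0 // => a b c r /nP.
  by rewrite (perm_catCA [:: u] [:: v] [:: w]).
- move=> u v w Quvw nP; rewrite triC23 Quvw ?oppr0 // => a b c r /nP.
  have /permPl-> // : perm_eq [:: u; w; v] [:: u; v; w].
  by rewrite perm_cons; apply/permPl/(perm_catC [:: w] [:: v]).
have E := (k01, k12, k20, e0, e1, e2, e3, e4, e5, e6, e7, e8, e9).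
move=> a b c ab bc.
have [/= a_lt4|a_ge4] := ltnP (gen_rank a) 4.
  case: a ab a_lt4 => i /=; last by case: i.
  by case: ifP => // /negbT i0 _ _ _; apply/tri_center1/Zx.
have listed u v w : (forall a' b' c' r, (a', b', c', r) \in P10_4_1 F ->
    ~~ perm_eq [:: u; v; w] [:: a'; b'; c']) -> (u, v, w, 1) \in P10_4_1 F -> False.
  by move=> nP /nP; rewrite perm_refl.
case: a ab a_ge4 => i; elim/ord5_ind: i => //.
all: case: b bc => j; elim/ord5_ind: j => //.
all: case: c => k; elim/ord5_ind: k => //.
all: move=> _ _ _; rewrite /Q /= => /listed nP; rewrite ?E //.
all: by case: nP; rewrite !inE eqxx ?orbT.
Qed.

(** A frame is independent modulo the center, so the center has dimension at most
4 and is spanned by x_2, ..., x_5. A product pw with p orthogonal to the center is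
orthogonal to x_1, ..., x_5, y_1 and y_2: orthogonality to all but y_2 places L^3 in
the center, and orthogonality to y_2 makes it miss x_2. *)
Lemma frame_class : class10_4_1 L.
Proof.
have [bas xx yy xy] := sb; have dimL := standard_basis_dim sb.
have expand u : u = \sum_g gen_coord x y g u *: gen_val x y g.
  by apply: gen_expand; rewrite ?dimL.
pose X : {vspace L} := <<[:: x o1; x o2; x o3; x o4]>>%VS.
have sXZ : (X <= Z)%VS.
  by apply/span_subvP => u; rewrite !inE => /or4P[] /eqP->; apply: Zx.
have dimX : \dim X = 4%N.
  apply/eqP; rewrite -[_ == _]/(free _).
  have -> : [:: x o1; x o2; x o3; x o4] = behead (codom x).
    rewrite codomE !enum_ordSl /=; congr [:: _, _, _, _ & _].
    all: try by congr (x _); apply: val_inj.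
    by case: (enum _) => [|[]].
  have := catl_free (basis_free bas); case: (codom x) => //= u s.
  by rewrite free_cons => /andP[].
have Z_X : Z = X.
  apply/esym/eqP; rewrite eqEdim sXZ dimX.
  by have := frame_dim_center kf; rewrite dimL; lia.
have [[k01 k12 k20] _ _ _ _] := kf.
have orth_tri p w k : p \in orthv Z ->
    tri (x o0) w k = 0 -> tri (y o0) w k = 0 -> tri p w k = 0.
  move=> /orthvP Zp xk yk; rewrite [p]expand (scalar_sum _ _ (tri_scalar1 _ _)).
  rewrite big1 // => -[] i _ /=; have [->|i0] := eqVneq i o0; rewrite ?xk ?yk ?mulr0 //.
    by rewrite tri_center1 ?mulr0 ?Zx.
  by rewrite Zp ?mul0r ?Zx.
have px0 p w : p \in orthv Z -> tri p w (x o0) = 0.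
  by move=> Zp; apply: orth_tri; rewrite ?tri_alt13 // triC23 -[x o0]opprK triN2 k01 !oppr0.
have py0 p w : p \in orthv Z -> tri p w (y o0) = 0.
  move=> Zp; apply: orth_tri; rewrite ?tri_alt13 //.
  by rewrite triC23 triC -[x o0]opprK triN2 k01 !oppr0.
have py1 p w : p \in orthv Z -> tri p w (y o1) = 0.
  move=> Zp; apply: orth_tri; rewrite // triC23; last by rewrite triC k20 !oppr0.
  by rewrite -[x o0]opprK triN1 k12 !oppr0.
have PX p w : p \in orthv Z -> saa_mul L p w \in X.
  move=> Zp; rewrite [saa_mul L p w]expand; apply: memv_suml => -[] i _ /=.
    have [->|i0] := eqVneq i o0; first by rewrite [saa_form L _ _]py0 ?scale0r ?mem0v.
    by rewrite memvZ // memv_span //; elim/ord5_ind: i i0 => //; rewrite !inE eqxx ?orbT.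
  rewrite saa_formC; have [->|i0] := eqVneq i o0.
    by rewrite [saa_form L _ _]px0 ?oppr0 ?scale0r ?mem0v.
  by rewrite [saa_form L _ _]tri_center3 ?Zx ?oppr0 ?scale0r ?mem0v.
have L3Z : (saa_lcs L 3 <= Z)%VS by apply/lcs3_subP => p w /PX; rewrite Z_X.
split=> //; rewrite ?Z_X //.
- exists 3%N; apply/eqP; rewrite -subv0 [saa_lcs L 4]/(saa_prodv (saa_lcs L 3) fullv).
  by apply/saa_prodvP => u v /(subvP L3Z)/saa_centerP uL _; rewrite uL mem0v.
- have xX i u : u \in X -> saa_form L (x i) u = 0.
    suffices /subvP sX : (X <= orthv <[x i]>)%VS by move/sX; rewrite orthv_line => /eqP.
    by apply/span_subvP => v; rewrite orthv_line !inE => /or4P[] /eqP->; rewrite xx.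
  move=> u v Xu; suffices /subvP sX : (X <= orthv <[u]>)%VS.
    by move/sX; rewrite orthv_line => /eqP.
  apply/span_subvP => w; rewrite orthv_line saa_formC oppr_eq0 !inE.
  by move=> /or4P[] /eqP->; rewrite xX.
split; first by rewrite -Z_X.
move=> L3X; have /eqP := oner_neq0 F; apply.
have : (saa_lcs L 3 <= orthv <[y o1]>)%VS.
  by apply/lcs3_subP => p w Zp; rewrite orthv_line saa_formC oppr_eq0 [X in X == _]py1.
move=> /subvP/(_ (x o1)); rewrite L3X memv_span ?mem_head // orthv_line saa_formC xy oppr_eq0.
by move/(_ isT)/eqP.
Qed.

End FromFrame.

(** * Adapted bases in the algebras of the class *)

Section Adapt.
Variables (F : fieldType) (L : saa F).
Local Notation Z := (saa_center L).
Local Notation "⟨ u , v ⟩" := (saa_form L u v) (at level 0, format "⟨ u ,  v ⟩").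

Lemma tri_mod_center u v w u' v' w' :
  u' - u \in Z -> v' - v \in Z -> w' - w \in Z -> tri u' v' w' = tri u v w.
Proof.
move=> Zu Zv Zw; rewrite -[u'](subrK u) -[v'](subrK v) -[w'](subrK w).
by rewrite triD1 tri_center1 // add0r triD2 tri_center2 // add0r triD3 tri_center3 // add0r.
Qed.

Lemma frame_mod_center k0 k1 k2 f0 f1 f2 k0' k1' k2' f0' f1' f2' :
    k0' - k0 \in Z -> k1' - k1 \in Z -> k2' - k2 \in Z ->
    f0' - f0 \in Z -> f1' - f1 \in Z -> f2' - f2 \in Z ->
  frame k0 k1 k2 f0 f1 f2 -> frame k0' k1' k2' f0' f1' f2'.
Proof.
move=> Zk0 Zk1 Zk2 Zf0 Zf1 Zf2.
case=> [[k01 k12 k20] [e0 e1 e2] [e3 e4 e5] [e6 e7 e8] e9].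
have Zw w : w - w \in Z by rewrite subrr mem0v.
have kk k k' w l l' : l - k \in Z -> l' - k' \in Z -> tri l l' w = tri k k' w.
  by move=> Zk Zk'; apply: tri_mod_center (Zw w).
have ff k l : l - k \in Z ->
    (tri l f1' f2' = tri k f1 f2) * (tri l f2' f0' = tri k f2 f0) *
    (tri l f0' f1' = tri k f0 f1).
  by move=> Zk; split; first split; apply: tri_mod_center.
split; first by split=> w; [rewrite (kk k0 k1) | rewrite (kk k1 k2) | rewrite (kk k2 k0)].
all: by rewrite ?(ff k0 k0') ?(ff k1 k1') ?(ff k2 k2') ?(ff f0 f0').
Qed.

(** Subtracting from each y i the combination of the x j, for j > i, with
coefficients in the upper half of the alternating Gram matrix of y makes y isotropic.
Using only half of the matrix keeps the correction away from x 0, the only x that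
is not central in the application, and is what works in characteristic 2. *)
Lemma isotropic_dual n (x y : 'I_n -> L) (U : {vspace L}) :
    (forall i j, ⟨x i, x j⟩ = 0) -> (forall i j, ⟨x i, y j⟩ = (i == j)%:R) ->
    (forall i j : 'I_n, (i < j)%N -> x j \in U) ->
  exists y' : 'I_n -> L,
    [/\ forall i j, ⟨x i, y' j⟩ = (i == j)%:R, forall i j, ⟨y' i, y' j⟩ = 0
      & forall i, y' i - y i \in U].
Proof.
move=> xx xy xU; pose c (i j : 'I_n) := if (i < j)%N then - ⟨y i, y j⟩ else 0.
pose z i := \sum_j c i j *: x j.
have xz i j : ⟨x i, z j⟩ = 0.
  by rewrite (scalar_sum _ _ (form_scalarr _)) big1 // => k _; rewrite xx mulr0.
have zz i j : ⟨z i, z j⟩ = 0.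
  by rewrite (scalar_sum _ _ (form_scalarl _)) big1 // => k _; rewrite xz mulr0.
have zy i j : ⟨z i, y j⟩ = c i j.
  rewrite (scalar_sum _ _ (form_scalarl _)) (bigD1 j) //= xy eqxx mulr1.
  by rewrite big1 ?addr0 // => k /negPf kj; rewrite xy kj mulr0.
exists (fun i => y i + z i); split=> [i j|i j|i].
- by rewrite linearDr /= xy xz addr0.
- rewrite linearDl /= !linearDr /= zz zy addr0 saa_formC (saa_formC (y i) (z j)) zy /c.
  case: (ltngtP i j) => [_|_|/val_inj->].
  + by rewrite (saa_formC (y j)); ring.
  + by rewrite (saa_formC (y j)); ring.
  + by rewrite saa_form_alt; ring.
- rewrite addrC addKr; apply: memv_suml => j _; rewrite /c.
  by case: ltnP => [/xU|]; [apply: memvZ | rewrite scale0r mem0v].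
Qed.

End Adapt.

Section Uniqueness.
Variables (F : fieldType) (L : saa F).
Local Notation Z := (saa_center L).
Local Notation "⟨ u , v ⟩" := (saa_form L u v) (at level 0, format "⟨ u ,  v ⟩").
Hypothesis CL : class10_4_1 L.

Let P := orthv Z.

Let dimL : \dim {:L} = 10%N. Proof. by case: CL. Qed.
Let dimZ : \dim Z = 4%N. Proof. by case: CL. Qed.
Let dimP : \dim P = 6%N.
Proof. by have := dim_orthv Z; rewrite dimL dimZ; apply: (@addIn 4 _ 6). Qed.
Let ZP z p : z \in Z -> p \in P -> ⟨z, p⟩ = 0. Proof. exact: orthv_in. Qed.
Let sZP : (Z <= P)%VS.
Proof.
by case: CL => _ _ isoZ _ _; apply/subvP => z Zz; apply/orthvP => z' Zz'; apply: isoZ.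
Qed.
Let PL p w : p \in P -> saa_mul L p w \in Z.
Proof. by move=> Pp; case: CL => _ _ _ _ [/lcs3_subP L3Z _]; apply: L3Z. Qed.

(** P is larger than Z, and Z is the radical of the form on P. *)
Lemma class_hyperbolic :
  exists x0 y0, [/\ x0 \in P, y0 \in P & ⟨x0, y0⟩ = 1].
Proof.
have /subvPn[x0 Px0 Zx0] : ~~ (P <= Z)%VS.
  by apply/negP => /dimvS; rewrite dimP dimZ.
have /subvPn[p Pp] : ~~ (P <= orthv <[x0]>)%VS.
  apply: contra Zx0 => /orthvS; rewrite !orthvK => /subvP; apply; exact: memv_line.
rewrite orthv_line => x0p; exists x0, (⟨x0, p⟩^-1 *: p); split; rewrite ?memvZ //.
by rewrite linearZr_LR /= mulVf.
Qed.

(** If every vector orthogonal to L^3 were in P, then taking orthogonal complements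
Z would be contained in L^3. *)
Lemma class_annihilator :
  exists2 k2, k2 \notin P & forall p w, p \in P -> tri p w k2 = 0.
Proof.
have /subvPn[k2 L3k2 Pk2] : ~~ (orthv (saa_lcs L 3) <= P)%VS.
  apply/negP => /orthvS; rewrite !orthvK => sZL3.
  case: CL => _ _ _ _ [L3Z]; apply; apply/eqP; rewrite eqEsubv L3Z; exact: sZL3.
exists k2 => // p w Pp; apply: (orthv_in _ L3k2).
by move: p w Pp; apply/lcs3_subP.
Qed.

(** Adding to P the vector k2 orthogonal to L^3 gives K of codimension 3 with
phi(K, K, L) = 0, to which [radical_frame] applies. *)
Lemma class_frame : exists x0 y0 y1 f0 f1 f2,
  [/\ x0 \in P, y0 \in P, ⟨x0, y0⟩ = 1 & frame y0 (- x0) y1 f0 f1 f2].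
Proof.
have [x0 [y0 [Px0 Py0 xy]]] := class_hyperbolic.
have [k2 Pk2 k2P] := class_annihilator.
pose K := (P + <[k2]>)%VS.
have KK k k' w : k \in K -> k' \in K -> tri k k' w = 0.
  have PP p p' : p \in P -> p' \in P -> tri p p' w = 0.
    by move=> Pp Pp'; rewrite triC23 [tri _ _ _]ZP ?PL ?oppr0.
  case/memv_addP=> p Pp [_ /vlineP[a ->] ->].
  case/memv_addP=> p' Pp' [_ /vlineP[a' ->] ->].
  rewrite !triE PP // tri_alt12 [tri p k2 w]triC23 k2P // [tri k2 p' w]triC.
  by rewrite [tri p' k2 w]triC23 k2P //; ring.
have dimK : \dim K = 7%N.
  rewrite dimv_disjoint_sum ?dimP ?dim_vline.
    by case: eqP Pk2 => // ->; rewrite mem0v.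
  apply/eqP; rewrite eqEsubv sub0v andbT; apply/subvP => v /memv_capP[Pv /vlineP[a Ev]].
  rewrite memv0 Ev; case: eqVneq Pk2 => // av0; rewrite -[k2](@scalerK _ _ a).
    by rewrite -Ev memvZ.
  by apply: contraNneq av0 => ->; rewrite scale0r.
have [e0 [e1 [e2 KeL]]] : exists e0 e1 e2, forall v, exists k a0 a1 a2,
    k \in K /\ v = k + (a0 *: e0 + a1 *: e1 + a2 *: e2).
  have /span_basis : basis_of K^C (vbasis K^C) by apply: vbasisP.
  have : size (vbasis K^C) = 3%N by rewrite size_tuple dimv_compl dimL dimK.
  case: (tval _) => [|e0 [|e1 [|e2 [|//]]]] // _ KC.
  exists e0, e1, e2 => v; have : v \in (K + K^C)%VS by rewrite addv_complf memvf.
  case/memv_addP=> k Kk [u]; rewrite -KC !span_cons span_nil addv0.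
  case/memv_addP=> _ /vlineP[a0 ->] [_ /memv_addP[_ /vlineP[a1 ->]]]
    [_ /vlineP[a2 ->] -> ->] ->.
  by exists k, a0, a1, a2; rewrite !addrA.
have sPK p : p \in P -> p \in K by move=> Pp; rewrite -[p]addr0 memv_add ?mem0v.
have [||||a [f0 [f1 [f2 kf]]]] := radical_frame KK KeL (k0 := y0) (k1 := - x0) (k2 := k2).
- exact: sPK.
- by rewrite memvN sPK.
- by rewrite -[k2]add0r memv_add ?mem0v ?memv_line.
- move=> a0 a1 a2; rewrite scalerN => Zk.
  have Pxy : a0 *: y0 - a1 *: x0 \in P by rewrite memvB ?memvZ.
  have a20 : a2 = 0.
    apply: contraNeq Pk2 => a20; rewrite -[k2](scalerK a20) memvZ //.
    rewrite -(addKr (a0 *: y0 - a1 *: x0) (a2 *: k2)) addrC memvB //.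
    exact: (subvP sZP).
  rewrite a20 scale0r addr0 in Zk; split=> //.
  + have := ZP Zk Px0; rewrite linearBl /= !linearZl_LR /= saa_form_alt saa_formC xy.
    by rewrite mulr0 subr0 mulrN1 => /eqP; rewrite oppr_eq0 => /eqP.
  + have := ZP Zk Py0; rewrite linearBl /= !linearZl_LR /= saa_form_alt xy.
    by rewrite mulr0 sub0r mulr1 => /eqP; rewrite oppr_eq0 => /eqP.
by exists x0, y0, (a *: k2), f0, f1, f2.
Qed.

(** L is spanned by Z and a frame, and a central vector is orthogonal to P; hence
pairing with y_2, ..., y_5 is injective on Z, which yields the dual vectors
x_2, ..., x_5. Correcting x_1 and then the y's by central vectors gives a standard
basis, and leaves a frame since phi ignores the center. *)
Lemma class_presented : presented_by L (P10_4_1 F).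
Proof.
have [x0 [y0 [y1 [f0 [f1 [f2 [Px0 Py0 xy0 kf]]]]]]] := class_frame.
pose f : 'I_4 -> L := tnth [tuple y1; f0; f1; f2].
have ZZ : {in Z &, forall u v, ⟨u, v⟩ = 0} by case: CL.
have [||s Zs sf] := dual_family (fun i => form_scalarl (f i)) (U := Z).
- by rewrite dimZ card_ord.
- move=> z Zz zf; apply: saa_form_nondeg => v; apply/eqP; rewrite -orthv_line.
  have : v \in (Z + <<[:: y0; - x0; y1; f0; f1; f2]>>)%VS.
    by apply: (frame_span kf); rewrite dimZ dimL.
  apply: subvP; rewrite subv_add; apply/andP; split.
    by apply/subvP => u Zu; rewrite orthv_line ZZ.
  apply/span_subvP => u; rewrite orthv_line !inE.
  case/or4P=> [|||/or3P[]] /eqP->; rewrite ?linearNr /= ?(ZP Zz Px0) ?(ZP Zz Py0) ?oppr0 //.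
  + apply/eqP; exact: (zf (@Ordinal 4 0 isT)).
  + apply/eqP; exact: (zf (@Ordinal 4 1 isT)).
  + apply/eqP; exact: (zf (@Ordinal 4 2 isT)).
  + apply/eqP; exact: (zf (@Ordinal 4 3 isT)).
pose xi := x0 - \sum_i ⟨x0, f i⟩ *: s i.
have Zxi : xi - x0 \in Z.
  by rewrite addrC addKr memvN; apply: memv_suml => i _; rewrite memvZ.
have Pxi : xi \in P by rewrite -[xi](subrK x0) memvD // (subvP sZP).
pose x i := if unlift (@ord0 4) i is Some j then s j else xi.
pose y i := if unlift (@ord0 4) i is Some j then f j else y0.
have xx i j : ⟨x i, x j⟩ = 0.
  rewrite /x; case: unliftP => [i' _|_]; case: unliftP => [j' _|_].
  - exact: ZZ.
  - exact: ZP.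
  - by rewrite saa_formC ZP ?oppr0.
  - exact: saa_form_alt.
have xy i j : ⟨x i, y j⟩ = (i == j)%:R.
  rewrite /x /y; case: unliftP => [i' ->|->]; case: unliftP => [j' ->|->].
  + by rewrite sf (inj_eq lift_inj) eq_sym.
  + by rewrite ZP.
  + rewrite linearBl /= (scalar_sum _ _ (form_scalarl _)) (bigD1 j') //= sf eqxx mulr1.
    by rewrite big1 ?addr0 ?subrr // => k /negPf kj; rewrite sf eq_sym kj mulr0.
  + rewrite eqxx -[xi](subrK x0) linearDl /= xy0 ZP ?add0r //.
have [|y' [xy' yy' yZ]] := isotropic_dual (U := Z) xx xy.
  move=> i j ij; rewrite /x; case: unliftP => [j' _|Ej] //.
  by rewrite Ej in ij.
have Zy0 : y' (@Ordinal 5 0 isT) - y0 \in Z.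
  by have := yZ (@Ordinal 5 0 isT); rewrite /y (_ : Ordinal _ = ord0) ?unlift_none //;
     apply: val_inj.
have Zyf (j : 'I_4) lt_j : y' (@Ordinal 5 j.+1 lt_j) - f j \in Z.
  by have := yZ (Ordinal lt_j); rewrite /y (_ : Ordinal lt_j = lift ord0 j) ?liftK //;
     apply: val_inj.
have Zx0 : - x (@Ordinal 5 0 isT) - - x0 \in Z.
  rewrite -opprD memvN /x (_ : Ordinal _ = ord0) ?unlift_none //; exact: val_inj.
apply: (frame_presented (standard_basisP xx yy' xy' dimL)) => [i i0|].
  by rewrite /x; case: unliftP i0 => // ->.
apply: frame_mod_center kf => //.
- exact: (Zyf (@Ordinal 4 0 isT) isT).
- exact: (Zyf (@Ordinal 4 1 isT) isT).
- exact: (Zyf (@Ordinal 4 2 isT) isT).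
- exact: (Zyf (@Ordinal 4 3 isT) isT).
Qed.
End Uniqueness.

(** * The algebra of an alternating trilinear form *)

Section TrilinearModel.
Variables (F : fieldType) (n : nat).
Local Notation V := {ffun saa_gen n -> F^o}.

Definition gen_vec (g : saa_gen n) : V := [ffun h => (g == h)%:R].

Lemma gen_vec_expand (u : V) : u = \sum_g u g *: gen_vec g.
Proof.
apply/ffunP => h; rewrite sum_ffunE (bigD1 h) //= !ffunE eqxx [_ *: _]mulr1.
by rewrite big1 ?addr0 // => g /negPf gh; rewrite !ffunE gh [_ *: _]mulr0.
Qed.

Definition model_form (u v : V) : F :=
  \sum_i (u (inl i) * v (inr i) - u (inr i) * v (inl i)).

Lemma model_form_bilinear :
  bilinear_for (GRing.Scale.Law.clone _ _ *%R _) (GRing.Scale.Law.clone _ _ *%R _) model_form.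
Proof.
split=> w a u v; rewrite /= /model_form mulr_sumr -big_split; apply: eq_bigr => i _ /=;
  rewrite !ffunE /GRing.scale /=; ring.
Qed.
HB.instance Definition _ := bilinear_isBilinear.Build F V V F
  (GRing.Scale.Law.clone _ _ *%R _) (GRing.Scale.Law.clone _ _ *%R _)
  model_form model_form_bilinear.

Lemma model_form_alt u : model_form u u = 0.
Proof. by rewrite /model_form big1 // => i _; rewrite mulrC subrr. Qed.

Lemma model_form_gen u i :
  (model_form u (gen_vec (inr i)) = u (inl i)) *
  (model_form u (gen_vec (inl i)) = - u (inr i)).
Proof.
split; rewrite /model_form (bigD1 i) //= big1 ?addr0 => [|j ji]; rewrite !ffunE /=.
- by rewrite eqxx mulr0 mulr1 subr0.
- by rewrite (inj_eq inr_inj) eq_sym (negPf ji) !mulr0 subrr.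
- by rewrite eqxx mulr0 mulr1 sub0r.
- by rewrite (inj_eq inl_inj) eq_sym (negPf ji) !mulr0 subrr.
Qed.

Lemma model_form_nondeg u : (forall v, model_form u v = 0) -> u = 0.
Proof.
move=> u0; apply/ffunP => -[] i; rewrite ffunE; first by rewrite -(model_form_gen u i).1.
by apply/eqP; rewrite -oppr_eq0 -(model_form_gen u i).2 u0.
Qed.

Variable t : V -> V -> V -> F.
Hypotheses (t_lin3 : forall u v, scalar (t u v)) (t_alt : forall u w, t u u w = 0)
  (t_rot : forall u v w, t u v w = t v w u).

(** The only product with (uv, w) = t(u, v, w): the coordinate of uv on x_i is
(uv, y_i), and the one on y_i is -(uv, x_i). *)
Definition model_mul (u v : V) : V :=
  [ffun g => match g with
             | inl i => t u v (gen_vec (inr i))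
             | inr i => - t u v (gen_vec (inl i))
             end].

Lemma model_form_mul u v w : model_form (model_mul u v) w = t u v w.
Proof.
rewrite {2}[w]gen_vec_expand (scalar_sum _ _ (t_lin3 u v)) big_sumType /= /model_form.
rewrite big_split addrC /=; congr (_ + _); apply: eq_bigr => i _; rewrite !ffunE.
  by rewrite mulrC.
by rewrite mulNr opprK mulrC.
Qed.

Lemma model_mul_bilinear :
  bilinear_for (GRing.Scale.Law.clone _ _ *:%R _) (GRing.Scale.Law.clone _ _ *:%R _) model_mul.
Proof.
have t_lin1 v w a u u' : t (a *: u + u') v w = a * t u v w + t u' v w.
  by rewrite !(t_rot _ v w) t_lin3.
have t_lin2 u w a v v' : t u (a *: v + v') w = a * t u v w + t u v' w.
  by rewrite -!(t_rot w u) t_lin3.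
split=> w a u v; apply/ffunP=> -[] i; rewrite !ffunE /= ?ffunE.
all: by rewrite ?t_lin1 ?t_lin2 ?opprD -?mulrN.
Qed.
HB.instance Definition _ := bilinear_isBilinear.Build F V V V
  (GRing.Scale.Law.clone _ _ *:%R _) (GRing.Scale.Law.clone _ _ *:%R _)
  model_mul model_mul_bilinear.

Lemma model_mul_alt u : model_mul u u = 0.
Proof. by apply/ffunP=> -[] i; rewrite !ffunE t_alt ?oppr0. Qed.

Lemma model_rot u v w :
  model_form (model_mul u v) w = model_form (model_mul v w) u.
Proof. by rewrite !model_form_mul t_rot. Qed.

Definition trilinear_saa : saa F :=
  Saa (saa_car := V) (saa_form := model_form) (saa_mul := model_mul)
   model_form_alt model_form_nondeg model_mul_alt model_rot.

End TrilinearModel.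

(** * The algebra of the presentation *)

Section Model.
Variable F : fieldType.
Local Notation V := {ffun saa_gen 5 -> F^o}.
Local Notation x1 := (inl (@Ordinal 5 0 isT) : saa_gen 5).
Local Notation y1 := (inr (@Ordinal 5 0 isT) : saa_gen 5).
Local Notation y2 := (inr (@Ordinal 5 1 isT) : saa_gen 5).
Local Notation y3 := (inr (@Ordinal 5 2 isT) : saa_gen 5).
Local Notation y4 := (inr (@Ordinal 5 3 isT) : saa_gen 5).
Local Notation y5 := (inr (@Ordinal 5 4 isT) : saa_gen 5).

Definition minor (a b c : saa_gen 5) (u v w : V) : F :=
  det3 (u a) (u b) (u c) (v a) (v b) (v c) (w a) (w b) (w c).

Definition P10_4_1_tri (u v w : V) : F :=
  minor y2 y3 y4 u v w + minor y1 y4 y5 u v w + minor x1 y3 y5 u v w.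

Lemma P10_4_1_tri_lin3 u v : scalar (P10_4_1_tri u v).
Proof. by move=> a w w'; rewrite /P10_4_1_tri /minor /det3 !ffunE /GRing.scale /=; ring. Qed.

Lemma P10_4_1_tri_alt u w : P10_4_1_tri u u w = 0.
Proof. by rewrite /P10_4_1_tri /minor /det3; ring. Qed.

Lemma P10_4_1_tri_rot u v w : P10_4_1_tri u v w = P10_4_1_tri v w u.
Proof. by rewrite /P10_4_1_tri /minor /det3; ring. Qed.

Definition P10_4_1_saa : saa F :=
  trilinear_saa P10_4_1_tri_lin3 P10_4_1_tri_alt P10_4_1_tri_rot.

Let x i : P10_4_1_saa := gen_vec F (inl i).
Let y i : P10_4_1_saa := gen_vec F (inr i).

Lemma tri_model (u v w : P10_4_1_saa) : tri u v w = P10_4_1_tri u v w.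
Proof. exact: (model_form_mul P10_4_1_tri_lin3). Qed.

Lemma model_standard_basis : standard_basis x y.
Proof.
apply: standard_basisP => [i j|i j|i j|].
- by rewrite /x [saa_form _ _ _]model_form_gen ffunE oppr0.
- by rewrite /y [saa_form _ _ _]model_form_gen ffunE.
- by rewrite /x /y [saa_form _ _ _]model_form_gen ffunE (inj_eq inl_inj).
- by rewrite dim_regular_ffun card_sum card_ord.
Qed.

Lemma model_center i : i != @Ordinal 5 0 isT -> x i \in saa_center P10_4_1_saa.
Proof.
elim/ord5_ind: i => // _; apply/centerP => v w; rewrite tri_model.
all: by rewrite /P10_4_1_tri /minor /det3 !ffunE /=; ring.
Qed.

Lemma model_frame :
  frame (y (@Ordinal 5 0 isT)) (- x (@Ordinal 5 0 isT)) (y (@Ordinal 5 1 isT))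
        (y (@Ordinal 5 2 isT)) (y (@Ordinal 5 3 isT)) (y (@Ordinal 5 4 isT)).
Proof.
split; [split=> w | split | split | split | ]; rewrite tri_model.
all: by rewrite /P10_4_1_tri /minor /det3 !ffunE /=; ring.
Qed.
End Model.

Theorem proposition6p1 (F : fieldType) :
  let C (L : saa F) :=
    [/\ saa_nilpotent L,
        \dim {:L} = 10%N,
        saa_isotropic (saa_center L),
        \dim (saa_center L) = 4%N
      & (saa_lcs L 3 <= saa_center L)%VS /\ saa_lcs L 3 <> saa_center L] in
  exists L : saa F,
    [/\ C L,
        forall L' : saa F, C L' -> saa_isomorphic L L'
      & presented_by L (P10_4_1 F)].
Proof.
move=> C; have sb := model_standard_basis F; have kf := @model_frame F.
have PL := frame_presented sb (@model_center F) kf.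
exists (P10_4_1_saa F); split=> //; first exact: frame_class sb (@model_center F) kf.
by move=> L' CL'; apply: presented_by_isomorphic PL (class_presented CL').
Qed.
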